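(* For a soft Multi-GM $(f_a)_{a\in\mathcal V}$ over a finite multi-graph $\mathcal G=(\mathcal V,\mathcal E)$, the minimum $$\min_{(b,\beta)\in\Pi}F^{(bp)}(b,\beta)$$ of the Bethe Free Energy over the polytope $\Pi$ is achieved within the (relative) interior of $\Pi$.
   Context: $\mathcal G=(\mathcal V,\mathcal E)$ is a finite undirected multi-graph; multiple edges and self-edges are allowed. Each $\alpha\in\mathcal E$ has two directed versions, $\alpha_d$ and its reverse $\bar\alpha_d$, and $u(\alpha_d)=u(\bar\alpha_d)=\alpha$. Each directed edge is attached to exactly one node: for an edge joining two distinct nodes one of its two directed versions is attached to each end node; for a self-edge both directed versions are attached to its node. $e_d(a)$ is the set of directed edges attached to node $a$, and $\Sigma_a=\{0,1\}^{e_d(a)}$. A Multi-GM is a collection of factors $f_a:\Sigma_a\to[0,\infty)$, $a\in\mathcal V$; it is soft if $f_a(s)>0$ for all $a\in\mathcal V$, $s\in\Sigma_a$. $\Pi$ is the polytope of $(b,\beta)$ with $b=(b_a(s))_{a\in\mathcal V,s\in\Sigma_a}$, $b_a(s)\in[0,1]$, $\beta\in[0,1]^{\mathcal E}$, such that $\sum_{s\in\Sigma_a}b_a(s)=1$ for all $a\in\mathcal V$ and $\sum_{s\in\Sigma_a,\,s_\gamma=1}b_a(s)=\beta_{u(\gamma)}$ for all $a\in\mathcal V$, $\gamma\in e_d(a)$. Its relative interior (interior relative to its affine hull) consists of the points of $\Pi$ with all $b_a(s)>0$ and all $0<\beta_\alpha<1$. Bethe Free Energy (with $0\log 0=0$):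 $$F^{(bp)}(b,\beta)=\sum_{a\in\mathcal V}\sum_{s\in\Sigma_a}b_a(s)\log\frac{b_a(s)}{f_a(s)}-\sum_{\alpha\in\mathcal E}\bigl(\beta_\alpha\log\beta_\alpha+(1-\beta_\alpha)\log(1-\beta_\alpha)\bigr).$$ *)

(* Defs.v *)
From HB Require Import structures.
From mathcomp Require Import all_boot all_order all_algebra.
From mathcomp Require Import all_classical all_reals all_analysis.

Set Implicit Arguments.
Unset Strict Implicit.
Unset Printing Implicit Defensive.

Import Order.TTheory GRing.Theory Num.Theory numFieldNormedType.Exports.

Local Open Scope classical_set_scope.
Local Open Scope ring_scope.

Definition affine_hull (R : realType) (V : lmodType R) (A : set V) : set V :=
  [set x | exists (n : nat) (y : 'I_n -> V) (c : 'I_n -> R),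
    [/\ forall i, A (y i), \sum_(i < n) c i = 1
      & x = \sum_(i < n) c i *: y i]].

(* [subspace D] makes the points outside D isolated; this is harmless here
   because A is contained in its affine hull. *)
Definition relative_interior (R : realType) (V : normedModType R)
    (A : set V) : set V :=
  interior (A : set (subspace (affine_hull A))).

(* The directed versions of an edge e are (e, false) and (e, true); which of
   them carries which label is an arbitrary choice, so the graph is undirected.
   The end nodes of e are attach (e, false) and attach (e, true), and e is a
   self-edge when these coincide. *)
Record multigraph := Multigraph {
  node : finType;
  edge : finType;
  attach : edge * bool -> node }.

Definition dedge (G : multigraph) : finType := (edge G * bool)%type.

Definition under (G : multigraph) (g : dedge G) : edge G := g.1.

Definition dedge_at (G : multigraph) (a : node G) : finType :=
  {g : dedge G | attach g == a}.

Definition config (G : multigraph) (a : node G) : finType :=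
  {ffun dedge_at a -> bool}.

Record multiGM (R : realType) (G : multigraph) := MultiGM {
  factor : forall a : node G, config a -> R;
  factor_ge0 : forall (a : node G) (s : config a), 0 <= factor s }.

Definition soft (R : realType) (G : multigraph) (M : multiGM R G) : Prop :=
  forall (a : node G) (s : config a), 0 < factor M s.

(* Pairs (b, beta), with the families b = (b_a(s)) and beta flattened into row
   vectors so that they live in a normed space; the coordinates are read with
   [node_belief] and [edge_belief] only. *)
Definition belief (R : realType) (G : multigraph) : normedModType R :=
  ('rV[R]_#|{: {a : node G & config a}}| * 'rV[R]_#|edge G|)%type.

Definition node_belief (R : realType) (G : multigraph) (p : belief R G)
    (a : node G) (s : config a) : R :=
  p.1 ord0 (enum_rank (Tagged (@config G) s)).

Definition edge_belief (R : realType) (G : multigraph) (p : belief R G)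
    (e : edge G) : R :=
  p.2 ord0 (enum_rank e).

Definition bethe_polytope (R : realType) (G : multigraph) : set (belief R G) :=
  [set p : belief R G |
    [/\ forall (a : node G) (s : config a), 0 <= node_belief p s <= 1,
        forall e : edge G, 0 <= edge_belief p e <= 1,
        forall a : node G, \sum_(s : config a) node_belief p s = 1
      & forall (a : node G) (g : dedge_at a),
          \sum_(s : config a | s g) node_belief p s
            = edge_belief p (under (val g))]].
Arguments bethe_polytope R G _ : clear implicits.

(* The convention 0 log 0 = 0 holds since ln 0 = 0. The formula is meant for
   soft models: where b_a(s) > 0 = f_a(s) the term should be +oo, but x / 0 = 0
   makes it 0. *)
Definition bethe_free_energy (R : realType) (G : multigraph) (M : multiGM R G)
    (p : belief R G) : R :=
  \sum_(a : node G) \sum_(s : config a)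
      node_belief p s * ln (node_belief p s / factor M s)
  - \sum_(e : edge G)
      (edge_belief p e * ln (edge_belief p e)
       + (1 - edge_belief p e) * ln (1 - edge_belief p e)).

(* Main.v *)
(** The free energy is continuous on the compact polytope, so it has a minimizer
[p]. For a feasible direction [v] the expansion of the free energy at
[p + t *: v], as [t] tends to [0] from above, has leading term
[K * (t * ln t)]: only the vanishing coordinates contribute, node beliefs
[b_a(s) = 0] with weight [v_a(s)] and edge beliefs at [0] or [1] with the
opposite sign. Since [t * ln t < 0], minimality forces [K <= 0].

If [beta_e] were [0] or [1], flipping the value at each of the two half-edges of
[e] in a configuration of the support would give [K >= 2 - 1 > 0]: each edge has
two half-edges but one edge entropy. So [0 < beta_e < 1] for all [e]; then no
edge term contributes any more, and the direction towards the (positive) product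
belief with the same [beta] would give [K > 0] if some [b_a(s)] vanished. *)

Require Import Defs.
From mathcomp Require Import all_boot all_order all_algebra.
From mathcomp Require Import all_classical all_reals all_analysis.
From mathcomp Require Import ring lra.

Set Implicit Arguments.
Unset Strict Implicit.
Unset Printing Implicit Defensive.

Import Order.TTheory GRing.Theory Num.Theory numFieldNormedType.Exports.

Local Open Scope classical_set_scope.
Local Open Scope ring_scope.

(** * The function [x * ln x] and expansions at the scale [t * ln t] *)

Section XLnX.
Variable R : realType.
Implicit Types (x d k c : R) (h : R -> R).

Definition xlnx x : R := x * ln x.

Lemma xlnx_le0 x : x <= 0 -> xlnx x = 0.
Proof. by move=> x0; rewrite /xlnx ln0 ?mulr0. Qed.

(** For [x = y ^+ 2] with [y > 0], [xlnx x] is [2 * y * (y * ln y)], and [- ln y = ln y^-1 < y^-1]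
    gives [y * ln y > -1]. The bound serves to squeeze [xlnx] at 0. *)
Lemma xlnx_bounds x : x <= 1 -> - (2 * Num.sqrt x) <= xlnx x <= 0.
Proof.
have [x0 _|x0 x1] := leP x 0.
  by rewrite xlnx_le0// ler0_sqrtr// mulr0 oppr0 lexx.
apply/andP; split; last by rewrite /xlnx pmulr_rle0// ln_le0.
have y0 : 0 < Num.sqrt x by rewrite sqrtr_gt0.
set y := Num.sqrt x in y0 *.
have -> : x = y ^+ 2 by rewrite sqr_sqrtr// ltW.
rewrite /xlnx lnXn// -mulr_natr.
have : - ln y < y^-1 by rewrite -lnV ?posrE// ln_sublinear// invr_gt0.
rewrite -(ltr_pM2l y0) divff ?gt_eqF// => h.
have := ltr_pM2l y0 (y * - ln y) 1; rewrite h mulr1 => h2.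
by apply: ltW; nra.
Qed.

(** Since [ln] is 0 on nonpositive reals, [xlnx] vanishes there; only continuity at 0 requires an
    estimate. *)
Lemma continuous_xlnx : continuous xlnx.
Proof.
move=> z; suff : forall x, xlnx y @[y --> x] --> xlnx x by apply.
move=> {z}x; have [x0|x0|->] := ltgtP x 0.
- apply: (@cvg_trans _ ((fun=> 0 : R) y @[y --> x])).
    apply: near_eq_cvg; near=> y; rewrite xlnx_le0//.
    by apply: ltW; near: y; exact: lt_nbhsl.
  by rewrite xlnx_le0 ?ltW//; apply: (@cvg_cst _ 0 _ (nbhs x)).
- apply: (@continuousM _ _ id (@ln R)); last exact: continuous_ln.
  by move=> A.
- rewrite xlnx_le0//.
  apply: (@squeeze_cvgr _ _ _ R (fun y => - (2 * Num.sqrt y)) (fun=> 0)).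
  + near=> y; apply: xlnx_bounds; apply: ltW; near: y.
    by apply: lt_nbhsl; exact: ltr01.
  + suff : - (2 * Num.sqrt y) @[y --> (0 : R)] --> - (2 * Num.sqrt (0 : R)).
      by rewrite sqrtr0 mulr0 oppr0.
    by apply: cvgN; apply: cvgM; [exact: cvg_cst|exact: sqrt_continuous].
  + exact: (@cvg_cst _ 0 _ (nbhs (0 : R))).
Unshelve. all: by end_near. Qed.

Section Continuity.
Variables (T : topologicalType) (f : T -> R).
Hypothesis cf : continuous f.

Lemma continuous_xlnx_scaled c : continuous (fun y => c * xlnx (f y / c)).
Proof.
move=> x; apply: cvgM; first exact: cvg_cst.
apply: continuous_cvg; first exact: continuous_xlnx.
by apply: cvgM; [exact: cf|exact: cvg_cst].
Qed.

Lemma continuous_binary_entropy :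
  continuous (fun y => xlnx (f y) + xlnx (1 - f y)).
Proof.
move=> x; apply: cvgD; apply: continuous_cvg; try exact: continuous_xlnx.
  exact: cf.
by apply: cvgB; [exact: cvg_cst|exact: cf].
Qed.

End Continuity.

(* [h t - h 0] is asymptotic to [k * (t * ln t)] at [0^+]: only the entropy of
   a vanishing coordinate contributes at this scale, which dominates [t]. *)
Definition entropic_slope h k :=
  (h t - h 0) / (t * ln t) @[t --> 0^'+] --> k.

Lemma near0_ln_lt0 : \forall t \near 0^'+, (0 < t :> R) && (ln t < 0).
Proof.
near=> t; have t0 : 0 < t by near: t; exact: nbhs_right_gt.
rewrite t0 ln_lt0// t0/=; near: t.
by apply: nbhs_right_lt; exact: ltr01.
Unshelve. all: by end_near. Qed.

(** Makes contributions of order [t] negligible against [t * ln t]. *)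
Lemma ln_inv_cvg0 : (ln t)^-1 @[t --> 0^'+] --> (0 : R).
Proof.
apply/ltr0_cvgV0; last exact: lnNy.
by apply: filterS near0_ln_lt0 => t /andP[].
Qed.

(** The limit only sees [t] with [0 < t] and [ln t < 0], where [t * ln t] is nonzero and the
    quotient can be simplified. *)
Lemma entropic_slope_quotient (q : R -> R) h k : q t @[t --> 0^'+] --> k ->
  (forall t, 0 < t -> ln t < 0 -> q t = (h t - h 0) / (t * ln t)) ->
  entropic_slope h k.
Proof.
move=> qk qE; apply: cvg_trans qk; apply: near_eq_cvg.
by apply: filterS near0_ln_lt0 => t /andP[t0 lt0]; exact: qE.
Qed.

Lemma entropic_slopeD h1 h2 k1 k2 :
  entropic_slope h1 k1 -> entropic_slope h2 k2 ->
  entropic_slope (fun t => h1 t + h2 t) (k1 + k2).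
Proof.
move=> s1 s2; apply: entropic_slope_quotient (cvgD s1 s2) _ => t _ _ /=.
by rewrite -mulrDl; congr (_ / _); ring.
Qed.

Lemma entropic_slopeM c h k :
  entropic_slope h k -> entropic_slope (fun t => c * h t) (c * k).
Proof.
move=> s; apply: entropic_slope_quotient (cvgM (cvg_cst c) s) _ => t _ _ /=.
by rewrite mulrA mulrBr.
Qed.

Lemma entropic_slopeN h k :
  entropic_slope h k -> entropic_slope (fun t => - h t) (- k).
Proof.
move=> /(@entropic_slopeM (-1)); rewrite mulN1r.
by under eq_fun do rewrite mulN1r.
Qed.

Lemma entropic_slope_sum (I : Type) (r : seq I) (h : I -> R -> R)
    (k : I -> R) :
  (forall i, entropic_slope (h i) (k i)) ->
  entropic_slope (fun t => \sum_(i <- r) h i t) (\sum_(i <- r) k i).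
Proof.
move=> s; apply: entropic_slope_quotient.
  exact: (cvg_big (@add_continuous R) _ (fun i (_ : xpredT i) => s i)).
by move=> t _ _; rewrite -sumrB mulr_suml.
Qed.

(** The quotient is [(h t - h 0) / t], which converges, times [(ln t)^-1], which tends to 0. *)
Lemma entropic_slope_derivable h : derivable h 0 1 -> entropic_slope h 0.
Proof.
move=> /cvg_dnbhs_at_right h'.
rewrite -[X in entropic_slope _ X](mulr0 ('D_1 h 0)).
apply: entropic_slope_quotient (cvgM h' ln_inv_cvg0) _ => t t0 lt0 /=.
by rewrite [_%:A]mulr1 addr0 invfM /GRing.scale/=; ring.
Qed.

(** For [x = 0 < d] the quotient is exactly [d + d * ln d / ln t]; for [x > 0] the function is
    differentiable at 0. The condition on [d] excludes [d < 0] at [x = 0], where the default value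
    of [ln] would make the slope 0 instead of [d]. *)
Lemma entropic_slope_xlnx x d : 0 <= x -> (x = 0 -> 0 <= d) ->
  entropic_slope (fun t => xlnx (x + t * d)) (d * (x == 0)%:R).
Proof.
rewrite le_eqVlt => /predU1P[<- /(_ erefl)|x0 _].
  rewrite eqxx mulr1 le_eqVlt => /predU1P[<-|d0].
    apply: entropic_slope_derivable.
    by under eq_fun do rewrite mulr0; exact: derivable_cst.
  rewrite -[X in entropic_slope _ X]addr0 -[X in _ + X](mulr0 (d * ln d)).
  apply: entropic_slope_quotient.
    exact: cvgD (cvg_cst d) (cvgM (cvg_cst (d * ln d)) ln_inv_cvg0).
  move=> t t0 lt0; rewrite /= mul0r addr0 add0r (@xlnx_le0 0)//.
  rewrite /xlnx lnM ?posrE//.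
  by field; rewrite (gt_eqF t0) (lt_eqF lt0).
rewrite gt_eqF// mulr0; apply: entropic_slope_derivable.
have dx : derivable xlnx (x + 0 * d) 1.
  rewrite mul0r addr0; apply: derivableM; first exact: derivable_id.
  by apply: ex_derive; exact: is_derive1_ln.
apply/derivable1_diffP.
rewrite (_ : (fun t => _) = xlnx \o (fun t => x + t * d))//.
apply: differentiable_comp; last exact/derivable1_diffP.
by apply/derivable1_diffP; exact: ex_derive.
Qed.

Lemma entropic_slope_le0 h k : entropic_slope h k ->
  (\forall t \near 0^'+, h 0 <= h t) -> k <= 0.
Proof.
move=> s hm; apply: (cvgr_to_le s); near=> t.
have /andP[t0 lt0] : (0 < t) && (ln t < 0) by near: t; exact: near0_ln_lt0.
rewrite ler_ndivrMr ?mul0r ?subr_ge0; last by rewrite pmulr_rlt0.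
by near: t.
Unshelve. all: by end_near. Qed.

End XLnX.

(** * Beliefs as vectors with linear, continuous coordinates *)

Section Beliefs.
Variables (R : realType) (G : multigraph).
Implicit Types (p q v : belief R G) (a : node G) (e : edge G).

Definition mkbelief (b : forall a, config a -> R) (beta : edge G -> R) :
    belief R G :=
  (\row_i b _ (tagged (enum_val i)), \row_i beta (enum_val i)).

Lemma node_belief_mk b beta a (s : config a) :
  node_belief (mkbelief b beta) s = b a s.
Proof. by rewrite /node_belief mxE enum_rankK. Qed.

Lemma edge_belief_mk b beta e : edge_belief (mkbelief b beta) e = beta e.
Proof. by rewrite /edge_belief mxE enum_rankK. Qed.

Lemma node_beliefD p q a (s : config a) :
  node_belief (p + q) s = node_belief p s + node_belief q s.
Proof. by rewrite /node_belief !mxE. Qed.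

Lemma node_beliefZ t p a (s : config a) :
  node_belief (t *: p) s = t * node_belief p s.
Proof. by rewrite /node_belief !mxE. Qed.

Lemma edge_beliefD p q e :
  edge_belief (p + q) e = edge_belief p e + edge_belief q e.
Proof. by rewrite /edge_belief !mxE. Qed.

Lemma edge_beliefZ t p e : edge_belief (t *: p) e = t * edge_belief p e.
Proof. by rewrite /edge_belief !mxE. Qed.

Lemma node_belief_comb (n : nat) (c : 'I_n -> R) (y : 'I_n -> belief R G) a
    (s : config a) :
  node_belief (\sum_i c i *: y i) s = \sum_i c i * node_belief (y i) s.
Proof.
rewrite (big_morph (fun p => node_belief p s) (id1 := 0) (op1 := +%R)).
- by apply: eq_bigr => i _; rewrite node_beliefZ.
- by move=> p q; rewrite node_beliefD.
- by rewrite /node_belief mxE.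
Qed.

Lemma edge_belief_comb (n : nat) (c : 'I_n -> R) (y : 'I_n -> belief R G) e :
  edge_belief (\sum_i c i *: y i) e = \sum_i c i * edge_belief (y i) e.
Proof.
rewrite (big_morph (fun p => edge_belief p e) (id1 := 0) (op1 := +%R)).
- by apply: eq_bigr => i _; rewrite edge_beliefZ.
- by move=> p q; rewrite edge_beliefD.
- by rewrite /edge_belief mxE.
Qed.

Lemma continuous_node_belief a (s : config a) :
  continuous (fun p : belief R G => node_belief p s).
Proof.
move=> p.
have c1 : {for p, continuous (fst : belief R G -> _)} by exact: cvg_fst.
have c2 := @coord_continuous R _ _ ord0 (enum_rank (Tagged (@config G) s)) p.1.
exact: continuous_comp c1 c2.
Qed.

Lemma continuous_edge_belief e :
  continuous (fun p : belief R G => edge_belief p e).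
Proof.
move=> p.
have c1 : {for p, continuous (snd : belief R G -> _)} by exact: cvg_snd.
have c2 := @coord_continuous R _ _ ord0 (enum_rank e) p.2.
exact: continuous_comp c1 c2.
Qed.

(** * The polytope and its compactness *)

Lemma sumr_predC (T : finType) (P : pred T) (F : T -> R) :
  \sum_(x | P x) F x = \sum_x F x - \sum_(x | ~~ P x) F x.
Proof. by rewrite [\sum_x F x](bigID P)/= addrK. Qed.

(** An entry of a nonnegative family with sum 1 is at most 1; the belief of [e] is a marginal at the
    node where [(e, false)] is attached, so it lies in the unit interval too. *)
Lemma bethe_polytopeP p : bethe_polytope R G p <->
  [/\ forall a (s : config a), 0 <= node_belief p s,
      forall a, \sum_(s : config a) node_belief p s = 1
    & forall a (g : dedge_at a),
        \sum_(s : config a | s g) node_belief p s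
          = edge_belief p (under (val g))].
Proof.
split=> [[b01 _ b1 bE]|[b0 b1 bE]].
  by split=> // a s; case/andP: (b01 a s).
split=> // [a s|e].
  rewrite b0 -(b1 a) (bigD1 s)//= lerDl.
  by apply: sumr_ge0 => *; exact: b0.
have att : attach (e, false) == attach (e, false) by [].
rewrite -(bE _ (exist _ (e, false) att : dedge_at _)).
rewrite sumr_ge0 => [|*]; last exact: b0.
rewrite sumr_predC b1 gerBl.
by apply: sumr_ge0 => *; exact: b0.
Qed.

(** A closed subset of the unit box: each constraint is the preimage of a closed set under a
    continuous function. *)
Lemma bethe_polytope_compact : compact (bethe_polytope R G).
Proof.
pose box : set (belief R G) :=
  [set u : 'rV[R]__ | forall i, `[0, 1]%classic (u ord0 i)] `*`
  [set u : 'rV[R]__ | forall i, `[0, 1]%classic (u ord0 i)].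
apply: (@subclosed_compact _ _ box).
- rewrite (_ : bethe_polytope R G =
    (\bigcap_(x : {a : node G & config a})
       [set p | 0 <= node_belief p (tagged x)]) `&`
    (\bigcap_a [set p | \sum_(s : config a) node_belief p s = 1]) `&`
    (\bigcap_(x : {a : node G & dedge_at a})
       [set p | \sum_(s : config (tag x) | s (tagged x)) node_belief p s
          - edge_belief p (under (val (tagged x))) = 0])); last first.
    apply/seteqP; split=> p.
      move=> /bethe_polytopeP[b0 b1 bE]; split; first split.
      + by move=> [a s] _; exact: b0.
      + by move=> a _; exact: b1.
      + by move=> [a g] _ /=; rewrite bE subrr.
    move=> [[b0 b1] bE]; apply/bethe_polytopeP; split.
    + by move=> a s; exact: (b0 (Tagged (@config G) s) I).
    + by move=> a; exact: b1.
    + move=> a g; apply/eqP; rewrite -subr_eq0; apply/eqP.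
      exact: (bE (Tagged (@dedge_at G) g) I).
  have csum (a : node G) (P : pred (config a)) :
      continuous (fun p : belief R G => \sum_(s | P s) node_belief p s).
    apply: continuous_big => [|s _]; first exact: add_continuous.
    exact: continuous_node_belief.
  apply: closedI; first apply: closedI; apply: closed_bigI.
  + move=> x _; apply: (@preimage_closed _ _ _ [set y : R | 0 <= y]).
      by move=> p _; exact: continuous_node_belief.
    exact: closed_ge.
  + move=> a _; apply: (@preimage_closed _ _ _ [set y : R | y = 1]).
      by move=> p _; exact: csum.
    exact: closed_eq.
  + move=> x _; apply: (@preimage_closed _ _ _ [set y : R | y = 0]).
      move=> p _; apply: cvgB; first exact: csum.
      exact: continuous_edge_belief.
    exact: closed_eq.
- have cbox n : compact
      [set u : 'rV[R]_n | forall i, `[0, 1]%classic (u ord0 i)].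
    apply: (@rV_compact R _ (fun=> `[0, 1]%classic)) => i.
    exact: segment_compact.
  exact: (compact_setX (cbox _) (cbox _)).
- move=> p [b01 beta01 _ _]; split=> i /=; rewrite in_itv/=.
  + have := b01 _ (tagged (enum_val i)).
    rewrite /node_belief; case E : (enum_val i) => [a s].
    by rewrite -[Tagged _ _]/(existT _ a s) -E enum_valK.
  + by have := beta01 (enum_val i); rewrite /edge_belief enum_valK.
Qed.

(** * Product beliefs: independent half-edges with prescribed means *)

Definition product_belief (beta : edge G -> R) a (s : config a) : R :=
  \prod_(g : dedge_at a)
    (if s g then beta (under (val g)) else 1 - beta (under (val g))).

Lemma sum_product_belief beta a :
  \sum_(s : config a) product_belief beta s = 1.
Proof.
rewrite /product_belief.
rewrite -(bigA_distr_bigA (fun (g : dedge_at a) (c : bool) =>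
  if c then beta (under (val g)) else 1 - beta (under (val g)))).
by apply: big1 => g _; rewrite big_bool/= addrC subrK.
Qed.

(** The indicator of [s g] is absorbed into the factor at [g], so the sum still factorizes: the
    factor at [g] sums to its mean, the others to 1. *)
Lemma marginal_product_belief beta a (g : dedge_at a) :
  \sum_(s : config a | s g) product_belief beta s = beta (under (val g)).
Proof.
pose F (h : dedge_at a) (c : bool) :=
  (if c then beta (under (val h)) else 1 - beta (under (val h)))
  * (if h == g then c%:R else 1).
transitivity (\sum_(s : config a) \prod_h F h (s h)).
  rewrite big_mkcond; apply: eq_bigr => s _.
  rewrite big_split/= -/(product_belief beta s) -big_mkcond big_pred1_eq.
  by case: (s g); rewrite ?mulr1 ?mulr0.
rewrite -(bigA_distr_bigA F) (bigD1 g)//= [X in _ * X]big1 => [|h /negbTE hg].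
  by rewrite big_bool/= /F eqxx !mulr1 mulr0 addr0.
by rewrite big_bool/= /F hg !mulr1 addrC subrK.
Qed.

Lemma product_belief_gt0 beta a (s : config a) :
  (forall e, 0 < beta e < 1) -> 0 < product_belief beta s.
Proof.
move=> beta01; apply: prodr_gt0 => g _.
by have /andP[b0 b1] := beta01 (under (val g)); case: ifP; rewrite ?subr_gt0.
Qed.

Lemma bethe_polytope_neq0 : bethe_polytope R G !=set0.
Proof.
exists (mkbelief (product_belief (fun=> 2^-1)) (fun=> 2^-1)).
apply/bethe_polytopeP; split=> [a s|a|a g].
- rewrite node_belief_mk ltW// product_belief_gt0// => e.
  by rewrite invr_gt0 ltr0n invf_lt1 ?ltr1n ?ltr0n.
- by under eq_bigr do rewrite node_belief_mk; exact: sum_product_belief.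
- under eq_bigr do rewrite node_belief_mk.
  by rewrite edge_belief_mk marginal_product_belief.
Qed.

(** Configurations that disagree with [c] at a half-edge of [e] have total belief 0 (through the
    complement when [c] is true), and all terms are nonnegative. *)
Lemma node_belief_eq0 p e (c : bool) : bethe_polytope R G p ->
  edge_belief p e = c%:R -> forall a (g : dedge_at a) (s : config a),
  under (val g) = e -> s g != c -> node_belief p s = 0.
Proof.
move=> /bethe_polytopeP[b0 b1 bE] pe a g s ge sg.
have := bE a g; rewrite ge pe; case: c sg {pe} => /= sg.
  rewrite sumr_predC b1 => /eqP; rewrite subr_eq addrC -subr_eq subrr eq_sym.
  move=> /eqP s0; apply: (psumr_eq0P _ s0) => [s' _|]; first exact: b0.
  by case: (s g) sg.
move=> s0; apply: (psumr_eq0P _ s0) => [s' _|]; first exact: b0.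
by case: (s g) sg.
Qed.

Lemma node_belief_gt0_exists p : bethe_polytope R G p ->
  exists s : forall a, config a, forall a, 0 < node_belief p (s a).
Proof.
move=> /bethe_polytopeP[b0 b1 _].
suff ex a : exists s : config a, 0 < node_belief p s.
  by have [s] := fin_all_exists ex; exists s.
apply: contrapT => /forallNP ps; have := b1 a.
rewrite big1 => [/eqP|s _]; first by rewrite eq_sym oner_eq0.
by apply/eqP; rewrite eq_le b0 andbT leNgt; apply/negP/ps.
Qed.

(* Flipping at a half-edge that is not attached to [a] does nothing. *)
Definition flip a (g : dedge G) (s : config a) : config a :=
  [ffun h => s h (+) (val h == g)].

Lemma flip_id a (g : dedge G) (s : config a) : attach g != a -> flip g s = s.
Proof.
move=> ga; apply/ffunP => h; rewrite ffunE.
case: eqP => [hg|]; last by rewrite addbF.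
by move: ga; rewrite -hg (valP h).
Qed.

(** * Feasible directions and the relative interior *)

Definition feasible_direction p v :=
  [/\ forall a, \sum_(s : config a) node_belief v s = 0,
      forall a (g : dedge_at a),
        \sum_(s : config a | s g) node_belief v s
          = edge_belief v (under (val g))
    & forall a (s : config a), node_belief p s = 0 -> 0 <= node_belief v s].

(** The equalities are linear and hold for every [t]; only nonnegativity restricts [t], through
    finitely many coordinates. *)
Lemma feasible_directionP p v : bethe_polytope R G p ->
  feasible_direction p v ->
  \forall t \near 0^'+, bethe_polytope R G (p + t *: v).
Proof.
move=> /bethe_polytopeP[b0 b1 bE] [v1 vE v0].
have : \forall t \near 0^'+, forall x : {a : node G & config a},
    0 <= node_belief (p + t *: v) (tagged x).
  apply: filter_forall => -[a s] /=.
  have [ps0|ps0] := eqVneq (node_belief p s) 0.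
    apply: filterS (nbhs_right_gt 0) => t t0.
    by rewrite node_beliefD node_beliefZ ps0 add0r mulr_ge0 ?(ltW t0) ?v0.
  have {}ps0 : 0 < node_belief p s by rewrite lt_def ps0 b0.
  have v1_gt0 : 0 < 1 + `|node_belief v s| by rewrite ltr_pwDl.
  near=> t.
  have t0 : 0 < t by near: t; exact: nbhs_right_gt.
  (* Adding 1 to the norm keeps the denominator positive even where the direction vanishes. *)
  have : t < node_belief p s / (1 + `|node_belief v s|).
    by near: t; apply: nbhs_right_lt; rewrite divr_gt0.
  rewrite node_beliefD node_beliefZ ltr_pdivlMr// => tp.
  have := ler_norm (- node_belief v s); rewrite normrN => vn.
  by nra.
apply: filterS => t pos; apply/bethe_polytopeP; split=> [a s|a|a g].
- exact: (pos (Tagged (@config G) s)).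
- under eq_bigr do rewrite node_beliefD node_beliefZ.
  by rewrite big_split/= -mulr_sumr b1 v1 mulr0 addr0.
- under eq_bigr do rewrite node_beliefD node_beliefZ.
  by rewrite big_split/= -mulr_sumr bE vE edge_beliefD edge_beliefZ.
Unshelve. all: by end_near. Qed.

(** The equalities pass to affine combinations, so they hold on the whole hull; strict positivity is
    an open condition. *)
Lemma bethe_relative_interior p : bethe_polytope R G p ->
  (forall a (s : config a), 0 < node_belief p s) ->
  relative_interior (bethe_polytope R G) p.
Proof.
move=> pP pos; rewrite /relative_interior /interior/=.
have hullp : affine_hull (bethe_polytope R G) p.
  exists 1%N, (fun=> p), (fun=> 1); split=> //.
    by rewrite big_ord1.
  by rewrite big_ord1 scale1r.
rewrite /nbhs/= -nbhs_subspace_in//.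
have : \forall q \near p, forall x : {a : node G & config a},
    0 < node_belief q (tagged x).
  apply: (@filter_forall _ _ _ _ (@nbhs_filter (belief R G) p)) => -[a s] /=.
  exact: cvgr_gt (@continuous_node_belief _ s p) _ (pos a s).
apply: filterS => q qpos [n [y [c [yP c1 qE]]]].
have {}yP i := (bethe_polytopeP (y i)).1 (yP i).
apply/bethe_polytopeP; split=> [a s|a|a g].
- exact: ltW (qpos (Tagged (@config G) s)).
- rewrite qE; under eq_bigr do rewrite node_belief_comb.
  rewrite exchange_big/= -c1; apply: eq_bigr => i _.
  by case: (yP i) => _ yi1 _; rewrite -mulr_sumr yi1 mulr1.
- rewrite qE; under eq_bigr do rewrite node_belief_comb.
  rewrite exchange_big/= edge_belief_comb; apply: eq_bigr => i _.
  by case: (yP i) => _ _ yiE; rewrite -mulr_sumr yiE.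
Qed.

(* The coefficient of [t * ln t] in the expansion of the free energy at
   [p + t *: v]: node entropies enter with the sign +, edge entropies with -. *)
Definition boundary_slope p v : R :=
  \sum_a \sum_(s : config a) node_belief v s * (node_belief p s == 0)%:R
  - \sum_e edge_belief v e
      * ((edge_belief p e == 0)%:R - (edge_belief p e == 1)%:R).

(** * Continuity and boundary expansion of the free energy *)

Section FreeEnergy.
Variable M : multiGM R G.
Hypothesis M_soft : soft M.

(* The scaling by the factor makes this valid without any sign condition on the
   beliefs, so that continuity follows from that of [xlnx]. *)
Lemma bethe_free_energyE p : bethe_free_energy M p =
  \sum_a \sum_(s : config a)
      Defs.factor M s * xlnx (node_belief p s / Defs.factor M s)
  - \sum_e (xlnx (edge_belief p e) + xlnx (1 - edge_belief p e)).
Proof.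
congr (_ - _); apply: eq_bigr => a _; apply: eq_bigr => s _.
by rewrite /xlnx mulrA mulrCA divff ?mulr1// gt_eqF// M_soft.
Qed.

Lemma continuous_bethe_free_energy : continuous (bethe_free_energy M).
Proof.
rewrite (_ : bethe_free_energy M =
    (fun p => \sum_a \sum_(s : config a)
      Defs.factor M s * xlnx (node_belief p s / Defs.factor M s))
    \- (fun p => \sum_e (xlnx (edge_belief p e) + xlnx (1 - edge_belief p e)))).
  move=> p; apply: continuousB.
    apply: continuous_big => [|a _]; first exact: add_continuous.
    apply: continuous_big => [|s _]; first exact: add_continuous.
    exact/continuous_xlnx_scaled/continuous_node_belief.
  apply: continuous_big => [|e _]; first exact: add_continuous.
  exact/continuous_binary_entropy/continuous_edge_belief.
by apply/funext => p; exact: bethe_free_energyE.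
Qed.

Lemma exists_bethe_minimizer : exists2 p, bethe_polytope R G p &
  forall q, bethe_polytope R G q ->
    bethe_free_energy M p <= bethe_free_energy M q.
Proof.
have [|p /set_mem pP pmin] := compact_EVT_min bethe_polytope_neq0
    bethe_polytope_compact (f := bethe_free_energy M).
  exact/continuous_subspaceT/continuous_bethe_free_energy.
by exists p => // q qP; apply: pmin; exact/mem_set.
Qed.

Lemma entropic_slope_bethe p v : bethe_polytope R G p ->
  feasible_direction p v ->
  entropic_slope (fun t => bethe_free_energy M (p + t *: v))
    (boundary_slope p v).
Proof.
move=> pP vp; have [_ _ v0] := vp.
have [b01 beta01 _ _] := pP.
(* A feasible direction carries sign conditions on node coordinates only; one feasible point with
   [t > 0] yields the signs of the edge coordinates where the edge belief is 0 or 1. *)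
have [t [t0 [_ tbeta01 _ _]]] :
    exists t : R, 0 < t /\ bethe_polytope R G (p + t *: v).
  have [t []] :=
    filter_ex (filterI (nbhs_right_gt 0) (feasible_directionP pP vp)).
  by exists t.
under eq_fun do rewrite bethe_free_energyE.
apply: entropic_slopeD; last apply: entropic_slopeN.
  apply: entropic_slope_sum => a; apply: entropic_slope_sum => s.
  have f0 := M_soft s.
  have /andP[ps0 _] := b01 a s.
  rewrite (_ : _ * _ = Defs.factor M s * (node_belief v s / Defs.factor M s
    * (node_belief p s / Defs.factor M s == 0)%:R)); last first.
    rewrite mulf_eq0 invr_eq0 (gt_eqF f0) orbF.
    by rewrite mulrA mulrCA divff ?mulr1// gt_eqF.
  under eq_fun do rewrite node_beliefD node_beliefZ mulrDl -mulrA.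
  apply: entropic_slopeM; apply: entropic_slope_xlnx.
    by rewrite divr_ge0// ltW.
  move=> /eqP; rewrite mulf_eq0 invr_eq0 (gt_eqF f0) orbF => /eqP /v0 vs0.
  by rewrite divr_ge0// ltW.
(* The complement [1 - edge_belief p e] moves with the opposite velocity, whence the difference of
   indicators. *)
apply: entropic_slope_sum => e; rewrite mulrBr -mulNr.
have /andP[pe0 pe1] := beta01 e.
have := tbeta01 e; rewrite edge_beliefD edge_beliefZ => /andP[te0 te1].
apply: entropic_slopeD.
  under eq_fun do rewrite edge_beliefD edge_beliefZ.
  apply: entropic_slope_xlnx => // pe; move: te0.
  by rewrite pe add0r pmulr_rge0.
under eq_fun do rewrite edge_beliefD edge_beliefZ opprD addrA -mulrN.
rewrite (_ : (edge_belief p e == 1) = (1 - edge_belief p e == 0)); last first.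
  by rewrite subr_eq0 eq_sym.
apply: entropic_slope_xlnx; first by rewrite subr_ge0.
move=> /eqP; rewrite subr_eq0 => /eqP pe; move: te1.
by rewrite -pe -subr_ge0 opprD addrA subrr add0r -mulrN pmulr_rge0.
Qed.

(** * Strict positivity at a minimizer *)

Section Minimizer.
Variable p : belief R G.
Hypothesis pP : bethe_polytope R G p.
Hypothesis pmin : forall q, bethe_polytope R G q ->
  bethe_free_energy M p <= bethe_free_energy M q.

Lemma boundary_slope_le0 v : feasible_direction p v -> boundary_slope p v <= 0.
Proof.
move=> vp; apply: (entropic_slope_le0 (entropic_slope_bethe pP vp)).
have := feasible_directionP pP vp; apply: filterS => t tP.
by rewrite scale0r addr0; exact: pmin.
Qed.

(** Moving mass from a support configuration to its flips at the two half-edges of [e] gives node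
    slope at least 2 against edge slope 1. The flips are made separately, so a self-edge is covered
    too. *)
Lemma minimizer_edge_belief_neq e (c : bool) : edge_belief p e != c%:R.
Proof.
apply/eqP => pe.
have [s0 s0_gt0] := node_belief_gt0_exists pP.
have [b0 b1 bE] := (bethe_polytopeP p).1 pP.
have s0E a (h : dedge_at a) : under (val h) = e -> s0 a h = c.
  move=> he; apply/eqP; apply: contraTT (s0_gt0 a) => sc.
  by rewrite (node_belief_eq0 pP pe he sc) ltxx.
(* At a node to which [(e, b)] is not attached, the flip is the identity and the term cancels. The
   edge coordinate is 1 if [c] is false and -1 if [c] is true. *)
pose v := mkbelief (fun a s => \sum_(b : bool)
    ((s == flip (e, b) (s0 a))%:R - (s == s0 a)%:R))
  (fun e' => (e' == e)%:R * (1 - c%:R *+ 2)).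
have sum_dirac a (Q : pred (config a)) (s : config a) :
    \sum_(s' | Q s') (s' == s)%:R = (Q s)%:R :> R.
  rewrite big_mkcond/= (bigD1 s)//= eqxx big1 ?addr0 => [|s' /negbTE ->].
    by case: (Q s).
  by case: (Q s').
have feas : feasible_direction p v.
  split=> [a|a g|a s ps].
  - under eq_bigr do rewrite node_belief_mk.
    rewrite exchange_big/= big1// => b _.
    by rewrite sumrB !(sum_dirac _ xpredT) subrr.
  - under eq_bigr do rewrite node_belief_mk.
    rewrite exchange_big/= edge_belief_mk big_bool/= !sumrB !sum_dirac !ffunE.
    (* At a half-edge of [e] exactly one of the two flips changes the value, from [c] to [~~ c]. *)
    have [ge|ge] := eqVneq (under (val g)) e; last first.
      have gb b : (val g == (e, b)) = false.
        by apply: contra_neqF ge => /eqP ->.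
      by rewrite !gb !addbF !subrr addr0 mul0r.
    rewrite (s0E _ _ ge) mul1r -ge /under; case: (val g) => e' b' /=.
    rewrite !xpair_eqE eqxx /=.
    by case: c {v s0E pe}; case: b' => /=; ring.
  - rewrite node_belief_mk; apply: sumr_ge0 => b _.
    case: (eqVneq s (s0 a)) => [ss0|_]; last by rewrite subr0.
    by move: (s0_gt0 a); rewrite -ss0 ps ltxx.
have := boundary_slope_le0 feas; apply/negP; rewrite -ltNge /boundary_slope.
have edgeK : \sum_e' edge_belief v e'
    * ((edge_belief p e' == 0)%:R - (edge_belief p e' == 1)%:R) = 1.
  rewrite (bigD1 e)//= big1 => [|e' /negbTE ee']; last first.
    by rewrite edge_belief_mk ee' !mul0r.
  rewrite edge_belief_mk eqxx pe; case: c {v s0E pe feas} => /=.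
    by rewrite eqxx oner_eq0 /=; ring.
  by rewrite eqxx eq_sym oner_eq0 /=; ring.
have nodeK a : \sum_(s : config a) node_belief v s * (node_belief p s == 0)%:R
    = \sum_(b : bool) (node_belief p (flip (e, b) (s0 a)) == 0)%:R.
  rewrite (eq_bigr (fun s => \sum_(b : bool) (if node_belief p s == 0
      then (s == flip (e, b) (s0 a))%:R - (s == s0 a)%:R else 0))).
    rewrite exchange_big/=; apply: eq_bigr => b _.
    rewrite -big_mkcond sumrB !(sum_dirac _ (fun s => node_belief p s == 0))/=.
    by rewrite (gt_eqF (s0_gt0 a)) subr0.
  move=> s _; rewrite node_belief_mk; case: (node_belief p s == 0).
    by rewrite mulr1.
  by rewrite mulr0 big1.
rewrite edgeK; under eq_bigr do rewrite nodeK.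
rewrite exchange_big/= subr_gt0.
(* For each [b], the node where [(e, b)] is attached already contributes 1, as the flipped
   configuration disagrees with [c] there. *)
apply: (@lt_le_trans _ _ (\sum_(b : bool) 1)); first by rewrite big_bool ltrDl.
apply: ler_sum => b _; rewrite (bigD1 (attach (e, b)))//=.
rewrite ler_wpDr ?sumr_ge0// (_ : node_belief _ _ = 0) ?eqxx//.
pose g : dedge_at (attach (e, b)) := exist _ (e, b) (eqxx _).
apply: (node_belief_eq0 pP pe (g := g)); rewrite // ffunE s0E// eqxx.
by case: (c).
Qed.

Lemma minimizer_edge_belief_itv e : 0 < edge_belief p e < 1.
Proof.
have [_ beta01 _ _] := pP; have /andP[e0 e1] := beta01 e.
by rewrite !lt_neqAle e0 e1 (minimizer_edge_belief_neq e true) eq_sym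
  (minimizer_edge_belief_neq e false).
Qed.

(** Towards the product belief the edge beliefs stay fixed, so the slope is the total product belief
    of the vanishing configurations, which is positive as soon as there is one. *)
Lemma minimizer_node_belief_gt0 a (s : config a) : 0 < node_belief p s.
Proof.
have [b0 b1 bE] := (bethe_polytopeP p).1 pP.
rewrite lt_def b0 andbT; apply/eqP => ps.
pose v := mkbelief
  (fun a s => product_belief (edge_belief p) s - node_belief p s) (fun=> 0).
have prod_gt0 a' (s' : config a') : 0 < product_belief (edge_belief p) s'.
  exact/product_belief_gt0/minimizer_edge_belief_itv.
have feas : feasible_direction p v.
  split=> [a'|a' g|a' s' ps'].
  - under eq_bigr do rewrite node_belief_mk.
    by rewrite sumrB sum_product_belief b1 subrr.
  - under eq_bigr do rewrite node_belief_mk.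
    by rewrite sumrB marginal_product_belief bE subrr edge_belief_mk.
  - by rewrite node_belief_mk ps' subr0 ltW.
have := boundary_slope_le0 feas; apply/negP; rewrite -ltNge /boundary_slope.
rewrite [X in _ - X]big1 => [|e _]; last by rewrite edge_belief_mk mul0r.
have term_ge0 a' (s' : config a') :
    0 <= node_belief v s' * (node_belief p s' == 0)%:R.
  have [ps'|_] := eqVneq (node_belief p s') 0; last by rewrite mulr0.
  by rewrite mulr1 node_belief_mk ps' subr0 ltW.
rewrite subr0 (bigD1 a)//= ltr_pwDl ?sumr_ge0// => [|a' _]; last first.
  exact: sumr_ge0.
rewrite (bigD1 s)//= ltr_pwDl ?sumr_ge0//.
by rewrite ps eqxx mulr1 node_belief_mk ps subr0.
Qed.

End Minimizer.
End FreeEnergy.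
End Beliefs.

Theorem mainTheorem5 (R : realType) (G : multigraph) (M : multiGM R G)
    (M_soft : soft M) :
  exists p : belief R G,
    relative_interior (bethe_polytope R G) p /\
    forall q : belief R G, bethe_polytope R G q ->
      bethe_free_energy M p <= bethe_free_energy M q.
Proof.
have [p pP pmin] := exists_bethe_minimizer M_soft.
exists p; split=> //; apply: bethe_relative_interior => //.
by move=> a s; exact: (minimizer_node_belief_gt0 M_soft pP pmin).
Qed.
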